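(* Let $\mathcal{O}$ be a one-dimensional noetherian domain with field of fractions $K$ whose normalization $\tilde{\mathcal{O}}$ is finitely generated over $\mathcal{O}$. Let $\mathcal{F}=\{x\in K\mid x\tilde{\mathcal{O}}\subseteq\mathcal{O}\}$ be the conductor of $\mathcal{O}$ in $\tilde{\mathcal{O}}$, let $\mathfrak{p}_1,\dots,\mathfrak{p}_r$ be the non-invertible maximal ideals of $\mathcal{O}$ and let $\mathfrak{P}_{i,1},\dots,\mathfrak{P}_{i,r_i}$ be the maximal ideals of $\tilde{\mathcal{O}}$ over $\mathfrak{p}_i$. The following statements are equivalent: (1) The canonical epimorphism $\mathcal{I}(\mathcal{O})\to\mathcal{I}(\tilde{\mathcal{O}})$, $\mathfrak{a}\mapsto\mathfrak{a}\tilde{\mathcal{O}}$, is injective. (2) The canonical epimorphism $\mathrm{Pic}(\mathcal{O})\to\mathrm{Pic}(\tilde{\mathcal{O}})$, $[\mathfrak{a}]\mapsto[\mathfrak{a}\tilde{\mathcal{O}}]$, is injective and $\tilde{\mathcal{O}}^*=\mathcal{O}^*$. (3) $(\tilde{\mathcal{O}}/\mathcal{F})^*=(\mathcal{O}/\mathcal{F})^*$. (4) $(\tilde{\mathcal{O}}/\mathcal{F})^*$ is trivial. (5) The following conditions hold: - $\mathcal{F}$ is squarefree, i.e. $\mathcal{F}=\prod_{i=1}^r\prod_{j=1}^{r_i}\mathfrak{P}_{i,j}$; - $\tilde{\mathcal{O}}/\mathfrak{P}_{i,j}\cong\mathbb{F}_2$ for all $1\le i\le r$ and $1\le j\le r_i$;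 - $r_i\ge2$ for all $1\le i\le r$.
   Context: The normalization $\tilde{\mathcal{O}}$ is the integral closure of $\mathcal{O}$ in $K$. For $A\in\{\mathcal{O},\tilde{\mathcal{O}}\}$, $\mathcal{I}(A)$ is the group of invertible fractional ideals of $A$, and $\mathrm{Pic}(A)=\mathcal{I}(A)/\{aA\mid a\in K^*\}$. The maps $\mathcal{I}(\mathcal{O})\to\mathcal{I}(\tilde{\mathcal{O}})$ and $\mathrm{Pic}(\mathcal{O})\to\mathrm{Pic}(\tilde{\mathcal{O}})$ are surjective. The conductor $\mathcal{F}$ is an ideal of both $\mathcal{O}$ and $\tilde{\mathcal{O}}$; in (3) the ring $\mathcal{O}/\mathcal{F}$ is regarded as a subring of $\tilde{\mathcal{O}}/\mathcal{F}$. A maximal ideal of $\mathcal{O}$ is invertible if it is invertible as a fractional ideal; the finitely many non-invertible maximal ideals are exactly those containing $\mathcal{F}$. If $\mathcal{O}=\tilde{\mathcal{O}}$, then $r=0$ and $\mathcal{F}=\tilde{\mathcal{O}}$ (the empty product). For a ring $B$, $B^*$ denotes its unit group (trivial for the zero ring). *)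

(* Defs.v *)
From HB Require Import structures.
From mathcomp Require Import all_boot all_order all_algebra.
From mathcomp Require Import fraction mxpoly.
From mathcomp Require Import boolp classical_sets functions.

Set Implicit Arguments.
Unset Strict Implicit.
Unset Printing Implicit Defensive.

Import GRing.Theory.

Local Open Scope ring_scope.
Local Open Scope classical_set_scope.

(* Everything takes place inside one field K: rings A, their ideals and their
   fractional ideals are all subsets of K.  The definitions below are meant for
   A a subring of K. *)

Definition submodule (K : fieldType) (A M : set K) : Prop :=
  [/\ M 0, (forall x y, M x -> M y -> M (x + y))
         & (forall a x, A a -> M x -> M (a * x))].

Definition span (K : fieldType) (A : set K) (s : seq K) : set K :=
  [set x | exists2 c : 'I_(size s) -> K, (forall i, A (c i))
                                       & x = \sum_(i < size s) c i * s`_i].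

Definition fin_gen (K : fieldType) (A M : set K) : Prop :=
  exists s : seq K, M = span A s.

Definition ideal (K : fieldType) (A I : set K) : Prop :=
  submodule A I /\ I `<=` A.

Definition prime_ideal (K : fieldType) (A P : set K) : Prop :=
  [/\ ideal A P, P <> A
    & (forall x y, A x -> A y -> P (x * y) -> P x \/ P y)].

Definition maximal_ideal (K : fieldType) (A M : set K) : Prop :=
  [/\ ideal A M, M <> A
    & (forall I, ideal A I -> M `<=` I -> I = M \/ I = A)].

Definition noetherian (K : fieldType) (A : set K) : Prop :=
  forall I, ideal A I -> fin_gen A I.

Definition prime_chain (K : fieldType) (A : set K) (n : nat)
    (P : nat -> set K) : Prop :=
  (forall i, (i <= n)%N -> prime_ideal A (P i)) /\
  (forall i, (i < n)%N -> P i `<` P i.+1).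

Definition krull_dim (K : fieldType) (A : set K) (n : nat) : Prop :=
  (exists P, prime_chain A n P) /\
  (forall m P, prime_chain A m P -> (m <= n)%N).

(* Product of modules: all finite sums of products. *)
Definition mulM (K : fieldType) (M N : set K) : set K :=
  [set x | exists2 s : seq (K * K), (forall u, u \in s -> M u.1 /\ N u.2)
                                  & x = \sum_(u <- s) u.1 * u.2].

Definition fractional_ideal (K : fieldType) (A M : set K) : Prop :=
  submodule A M /\
  exists d, [/\ A d, d != 0 & (forall x, M x -> A (d * x))].

Definition inv_ideals (K : fieldType) (A : set K) : set (set K) :=
  [set M | fractional_ideal A M /\
           exists2 N, fractional_ideal A N & mulM M N = A].

Definition extension (K : fieldType) (B M : set K) : set K := mulM M B.

Definition principal (K : fieldType) (A : set K) (c : K) : set K :=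
  [set c * a | a in A].

Definition pic_class (K : fieldType) (A M : set K) : set (set K) :=
  [set mulM (principal A c) M | c in [set c : K | c != 0]].

Definition Pic (K : fieldType) (A : set K) : set (set (set K)) :=
  [set pic_class A M | M in inv_ideals A].

(* The image of a whole class of A is a whole class of B, see
   pic_extension_class. *)
Definition pic_extension (K : fieldType) (B : set K) (C : set (set K)) :
    set (set K) :=
  [set extension B M | M in C].

Definition units (K : fieldType) (A : set K) : set K :=
  [set x | A x /\ exists2 y, A y & x * y = 1].

(* Elements of A / I are cosets, as subsets of K; hence A / I is literally a
   subset of B / I when A is a subring of B and I is an ideal of both.  Unlike
   with ring_quotient, I = A is allowed and A / I is then the zero ring. *)
Definition coset (K : fieldType) (I : set K) (x : K) : set K :=
  [set x + z | z in I].

Definition quot (K : fieldType) (A I : set K) : set (set K) :=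
  [set coset I x | x in A].

Definition coset_add (K : fieldType) (C D : set K) : set K :=
  [set x + y | x in C & y in D].

(* The setwise product of two cosets need not be a full coset, hence the
   translation by I. *)
Definition coset_mul (K : fieldType) (I C D : set K) : set K :=
  [set w + z | w in [set x * y | x in C & y in D] & z in I].

Definition quot_units (K : fieldType) (A I : set K) : set (set K) :=
  [set C | quot A I C /\
           exists2 D, quot A I D & coset_mul I C D = coset I 1].

Definition quot_isomorphic (K : fieldType) (A I : set K) (S : nzRingType) :
    Prop :=
  exists f : set K -> S,
    [/\ set_bij (quot A I) [set: S] f,
        f (coset I 1) = 1,
        (forall C D, quot A I C -> quot A I D ->
           f (coset_add C D) = f C + f D)
      & (forall C D, quot A I C -> quot A I D ->
           f (coset_mul I C D) = f C * f D)].

Definition base (R : idomainType) : set {fraction R} :=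
  range (@FracField.tofrac R).
Arguments base : clear implicits.

Definition normalization (R : idomainType) : set {fraction R} :=
  [set x | integralOver (@FracField.tofrac R) x].
Arguments normalization : clear implicits.

Definition conductor (K : fieldType) (A B : set K) : set K :=
  [set x | forall y, B y -> A (x * y)].

Definition noninvertible_maximal (K : fieldType) (A : set K) : set (set K) :=
  [set p | maximal_ideal A p /\ ~ inv_ideals A p].

Definition maximal_over (K : fieldType) (A B p : set K) : set (set K) :=
  [set P | maximal_ideal B P /\ P `&` A = p].

Lemma coset_addE (K : fieldType) (A I : set K) (x y : K) : ideal A I ->
  coset_add (coset I x) (coset I y) = coset I (x + y).
Proof.
move=> [[I0 Iadd _] _]; apply/seteqP; split=> w.
  move=> [_ [z Iz <-] [_ [t It <-] <-]].
  by exists (z + t); [exact: Iadd | rewrite addrACA].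
move=> [z Iz <-]; exists (x + z); first by exists z.
by exists y; [exists 0; rewrite ?addr0 | rewrite addrAC].
Qed.

Lemma coset_mulE (K : fieldType) (A I : set K) (x y : K) :
  ideal A I -> A x -> A y ->
  coset_mul I (coset I x) (coset I y) = coset I (x * y).
Proof.
move=> [[I0 Iadd Imul] IA] Ax Ay; apply/seteqP; split=> w.
  move=> [_ [_ [z Iz <-] [_ [t It <-] <-]] [u Iu <-]].
  exists (x * t + y * z + z * t + u).
    have Ixt : I (x * t) by exact: Imul.
    have Iyz : I (y * z) by exact: Imul.
    have Izt : I (z * t) by apply: Imul => //; exact: IA.
    by apply: (Iadd) => //; apply: (Iadd) => //; exact: Iadd.
  by rewrite mulrDl !mulrDr [z * y]mulrC !addrA.
move=> [z Iz <-]; exists (x * y); last by exists z.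
by exists x; [exists 0; rewrite ?addr0|exists y; first by exists 0; rewrite ?addr0].
Qed.

Lemma mulM_prod (K : fieldType) (M N : set K) (x y : K) :
  M x -> N y -> mulM M N (x * y).
Proof.
move=> Mx Ny; exists [:: (x, y)]; last by rewrite big_seq1.
by move=> u; rewrite inE => /eqP ->.
Qed.

Lemma mulM_ind (K : fieldType) (M N : set K) (P : K -> Prop) :
  P 0 -> (forall x y, P x -> P y -> P (x + y)) ->
  (forall x y, M x -> N y -> P (x * y)) -> forall x, mulM M N x -> P x.
Proof.
move=> P0 PD PM x [s]; elim: s x => [|u s IHs] x Hs ->; first by rewrite big_nil.
rewrite big_cons; apply: PD; last first.
  by apply: IHs => // v vs; apply: Hs; rewrite inE vs orbT.
by have [] := Hs u (mem_head _ _); apply: PM.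
Qed.

Lemma mulM0 (K : fieldType) (M N : set K) : mulM M N 0.
Proof. by exists [::]; rewrite ?big_nil. Qed.

Lemma mulMD (K : fieldType) (M N : set K) (x y : K) :
  mulM M N x -> mulM M N y -> mulM M N (x + y).
Proof.
move=> [s Hs ->] [t Ht ->]; exists (s ++ t); last by rewrite big_cat.
by move=> u; rewrite mem_cat => /orP[/Hs|/Ht].
Qed.

Lemma pic_extension_class (K : fieldType) (A B M : set K) :
  A 1 -> A `<=` B -> (forall x y, B x -> B y -> B (x * y)) ->
  pic_extension B (pic_class A M) = pic_class B (extension B M).
Proof.
move=> A1 AB BM.
suff E c : mulM (mulM (principal A c) M) B = mulM (principal B c) (mulM M B).
  rewrite /pic_extension /pic_class /extension image_comp.
  by apply: eq_imagel => c _ /=.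
have pA : principal A c c by exists 1; rewrite ?mulr1.
apply/seteqP; split; apply: mulM_ind; [exact: mulM0|exact: mulMD| |
  exact: mulM0|exact: mulMD|].
- move=> x b Hx Bb; move: x Hx; apply: mulM_ind.
  + by rewrite mul0r; apply: mulM0.
  + by move=> x y Hx Hy; rewrite mulrDl; apply: mulMD.
  move=> _ m [a Aa <-] Mm; have -> : c * a * m * b = c * (a * b) * m.
    by rewrite -!mulrA [m * b]mulrC.
  rewrite -[_ * m]mulr1 -mulrA; apply: mulM_prod; last exact/mulM_prod/AB.
  by exists (a * b) => //; apply: BM => //; apply: AB.
- move=> _ y [b Bb <-] My; move: y My; apply: mulM_ind.
  + by rewrite mulr0; apply: mulM0.
  + by move=> x y Hx Hy; rewrite mulrDr; apply: mulMD.
  move=> m b' Mm Bb'; have -> : c * b * (m * b') = c * m * (b * b').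
    by rewrite -!mulrA [b * (m * _)]mulrCA.
  by apply: mulM_prod; [exact: mulM_prod | exact: BM].
Qed.

(* Main.v *)
Require Import Defs.
From mathcomp Require Import all_boot all_order all_algebra.
From mathcomp Require Import fraction mxpoly generic_quotient ring zify.
From mathcomp Require Import boolp classical_sets functions.

(** Write B for the normalization of O and F for the conductor.  The five
    statements are tied together by one further condition: x ^ 2 - x lies in F
    for every x in B, that is, B / F is a Boolean ring.

    (1) => (2) is formal, a unit u of B giving the principal ideal u O, whose
    extension is B.

    (2) => (3): if u v = 1 modulo F, then u O + F and v O + F are inverse to
    each other as O-modules, and u O + F extends to B.  Under (2) it is then
    c O for a unit c of B, hence of O, so that u lies in O
    ([units_descend_of_pic]).

    (3) => (4), and (4) => Boolean, use only that every unit of B / F comes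
    from O.  If x ^ 2 lies in F then 1 + x b is a unit modulo F for every b in
    B, so x B is contained in O and x lies in F: the ring B / F is reduced
    ([conductor_radical]).  It is also zero-dimensional ([pi_regular]), hence
    every t in it is a product e w of an idempotent and a unit
    ([idempotent_times_unit]).  For a unit u,
      (u - 1) t = (e u + 1 - e) w - w
    is a difference of two units, so (u - 1) B is contained in O and u = 1
    modulo F.  As now w = 1 as well, t = e is idempotent.

    Boolean => (5): F is the intersection of the maximal ideals of B above it,
    all with two-element residue fields, and by comaximality the intersection
    is a product.  The maximal ideals of B above F are those above the
    non-invertible maximal ideals of O ([maximal_invertible],
    [contract_noninvertible]).  If at most one of them were over p_i, an
    element of O in all p_j with j <> i but outside p_i would multiply B into
    O, while F is contained in p_i ([at_least_two_over]).

    (5) => Boolean is immediate, and Boolean => (1) goes as follows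
    ([extension_injective]).  Let c be an invertible ideal of O with c B = B.
    Then F = F c is contained in c ^ 2, and x = x ^ 2 - (x ^ 2 - x) shows that
    c is contained in c ^ 2; cancelling c, O is contained in c.  The same holds
    for the inverse of c, whence c = O. *)

Set Implicit Arguments.
Unset Strict Implicit.
Unset Printing Implicit Defensive.

Import GRing.Theory.

Local Open Scope ring_scope.
Local Open Scope quotient_scope.
Local Open Scope classical_set_scope.

(** * Submodules, products and prime ideals of a subring of a field *)

Section Submodules.
Variable K : fieldType.
Implicit Types A B I J L M N P Q S : set K.

Definition is_subring A : Prop :=
  [/\ A 1, (forall x y, A x -> A y -> A (x - y))
         & (forall x y, A x -> A y -> A (x * y))].

Lemma subring1 A : is_subring A -> A 1.
Proof. by case. Qed.

Lemma subringB A x y : is_subring A -> A x -> A y -> A (x - y).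
Proof. by case=> _ AB _; exact: AB. Qed.

Lemma subringM A x y : is_subring A -> A x -> A y -> A (x * y).
Proof. by case=> _ _ AM; exact: AM. Qed.

Lemma subring0 A : is_subring A -> A 0.
Proof. by move=> hA; rewrite -(subrr 1); apply: subringB => //; exact: subring1. Qed.

Lemma subringN A x : is_subring A -> A x -> A (- x).
Proof. by move=> hA Ax; rewrite -sub0r; apply: subringB => //; exact: subring0. Qed.

Lemma subringD A x y : is_subring A -> A x -> A y -> A (x + y).
Proof.
by move=> hA Ax Ay; rewrite -[y]opprK; apply: subringB => //; exact: subringN.
Qed.

Lemma subringX A x n : is_subring A -> A x -> A (x ^+ n).
Proof.
move=> hA Ax; elim: n => [|n IHn]; first by rewrite expr0; exact: subring1.
by rewrite exprS; exact: subringM.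
Qed.

Lemma submod0 A M : submodule A M -> M 0.
Proof. by case. Qed.

Lemma submodD A M x y : submodule A M -> M x -> M y -> M (x + y).
Proof. by case=> _ MD _; exact: MD. Qed.

Lemma submodM A M a x : submodule A M -> A a -> M x -> M (a * x).
Proof. by case=> _ _ MM; exact: MM. Qed.

Lemma submodB A M x y : is_subring A -> submodule A M -> M x -> M y -> M (x - y).
Proof.
move=> hA hM Mx My; apply: (submodD hM) => //; rewrite -mulN1r.
by apply: (submodM hM) => //; apply: subringN => //; exact: subring1.
Qed.

Lemma submod_sum A M (T : Type) (r : seq T) (f : T -> K) :
  submodule A M -> (forall k, M (f k)) -> M (\sum_(k <- r) f k).
Proof.
by move=> hM Mf; apply: big_ind => [|x y|//]; [exact: submod0 hM | exact: submodD hM].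
Qed.

Lemma subring_submod A : is_subring A -> submodule A A.
Proof.
move=> hA; split=> [|x y|a x]; [exact: subring0 | exact: subringD |].
exact: subringM.
Qed.

Lemma restrict_submod A B M : A `<=` B -> submodule B M -> submodule A M.
Proof. by move=> AB [M0 MD MM]; split=> // a x /AB; exact: MM. Qed.

Lemma ideal1 A I : is_subring A -> ideal A I -> I 1 -> I = A.
Proof.
move=> hA [hI IA] I1; apply/seteqP; split=> // x Ax.
by rewrite -[x]mulr1; exact: submodM hI Ax I1.
Qed.

Lemma mem_span A (s : seq K) x : is_subring A -> x \in s -> Defs.span A s x.
Proof.
move=> hA xs; have ltx : (index x s < size s)%N by rewrite index_mem.
exists (fun i => if i == Ordinal ltx then 1 else 0).
  by move=> i; case: ifP => _; [exact: subring1 | exact: subring0].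
rewrite (bigD1 (Ordinal ltx)) //= eqxx mul1r nth_index // big1 ?addr0 // => i.
by move=> /negPf->; rewrite mul0r.
Qed.

Lemma span_le A (s : seq K) M :
  submodule A M -> (forall x, x \in s -> M x) -> Defs.span A s `<=` M.
Proof.
move=> hM Ms _ [c Ac ->]; apply: (submod_sum _ hM) => i.
by apply: (submodM hM) => //; apply: Ms; rewrite mem_nth.
Qed.

Lemma mulM_le A M N L : submodule A L ->
  (forall x y, M x -> N y -> L (x * y)) -> mulM M N `<=` L.
Proof.
by move=> hL MNL; apply: mulM_ind; [exact: submod0 hL | move=> x y; exact: submodD hL|].
Qed.

Lemma mulM_submod A M N : submodule A M -> submodule A (mulM M N).
Proof.
move=> hM; split=> [|x y|a x Aa]; [exact: mulM0 | exact: mulMD |].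
move: x; apply: mulM_ind => [|x y ax ay|x y Mx Ny].
- by rewrite mulr0; exact: mulM0.
- by rewrite mulrDr; exact: mulMD.
by rewrite mulrA; apply: mulM_prod => //; exact: submodM hM _ _.
Qed.

Lemma mulMS M M' N N' : M `<=` M' -> N `<=` N' -> mulM M N `<=` mulM M' N'.
Proof.
move=> MM NN; apply: mulM_ind; [exact: mulM0|exact: mulMD|] => x y /MM ? /NN ?.
exact: mulM_prod.
Qed.

Lemma mulMC M N : mulM M N = mulM N M.
Proof.
by apply/seteqP; split; apply: mulM_ind;
  [exact: mulM0|exact: mulMD| move=> x y ? ?; rewrite mulrC; exact: mulM_prod
  |exact: mulM0|exact: mulMD| move=> x y ? ?; rewrite mulrC; exact: mulM_prod].
Qed.

Lemma mulMA L M N : mulM L (mulM M N) = mulM (mulM L M) N.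
Proof.
have sub L' M' N' : mulM L' (mulM M' N') `<=` mulM (mulM L' M') N'.
  apply: mulM_ind; [exact: mulM0|exact: mulMD|] => x y Lx; move: y.
  apply: mulM_ind => [|y z ? ?|y z My Nz].
  - by rewrite mulr0; exact: mulM0.
  - by rewrite mulrDr; exact: mulMD.
  by rewrite mulrA; apply: mulM_prod => //; exact: mulM_prod.
apply/seteqP; split; first exact: sub.
rewrite (mulMC (mulM L M) N) (mulMC L M) (mulMC L (mulM M N)) (mulMC M N).
exact: sub.
Qed.

Lemma mulM_id A M : A 1 -> submodule A M -> mulM M A = M.
Proof.
move=> A1 hM; apply/seteqP; split.
  by apply: (mulM_le hM) => x a Mx Aa; rewrite mulrC; exact: submodM hM _ _.
by move=> x Mx; rewrite -[x]mulr1; exact: mulM_prod.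
Qed.

Lemma mul_principal A M c : A 1 -> submodule A M ->
  mulM (principal A c) M = [set c * x | x in M].
Proof.
move=> A1 hM; apply/seteqP; split.
  apply: mulM_ind => [|_ _ [x Mx <-] [y My <-]|_ x [a Aa <-] Mx].
  - by exists 0; [exact: submod0 hM | rewrite mulr0].
  - by exists (x + y); [exact: submodD hM _ _ | rewrite mulrDr].
  by exists (a * x); [exact: submodM hM _ _ | rewrite mulrA].
by move=> _ [x Mx <-]; apply: mulM_prod => //; exists 1; rewrite ?mulr1.
Qed.

Lemma scale_submod A M c : submodule A M -> submodule A [set c * x | x in M].
Proof.
move=> hM; split=> [|_ _ [x Mx <-] [y My <-]|a _ Aa [x Mx <-]].
- by exists 0; [exact: submod0 hM | rewrite mulr0].
- by exists (x + y); [exact: submodD hM _ _ | rewrite mulrDr].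
by exists (a * x); [exact: submodM hM _ _ | rewrite mulrCA].
Qed.

Definition adjoin A I x : set K := [set y + x * a | y in I & a in A].

Lemma adjoin_submod A I x :
  is_subring A -> submodule A I -> submodule A (adjoin A I x).
Proof.
move=> hA hI; split.
- by exists 0; [exact: submod0 hI|exists 0; [exact: subring0|rewrite mulr0 addr0]].
- move=> _ _ [y Iy [a Aa <-]] [z Iz [b Ab <-]].
  exists (y + z); first exact: submodD hI _ _.
  by exists (a + b); [exact: subringD | rewrite mulrDr addrACA].
move=> c _ Ac [y Iy [a Aa <-]]; exists (c * y); first exact: submodM hI _ _.
by exists (c * a); [exact: subringM | rewrite mulrDr [c * (x * a)]mulrCA].
Qed.

Lemma adjoin_ideal A I x :
  is_subring A -> ideal A I -> A x -> ideal A (adjoin A I x).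
Proof.
move=> hA [hI IA] Ax; split; first exact: adjoin_submod.
by move=> _ [y /IA Ay [a Aa <-]]; apply: subringD => //; exact: subringM.
Qed.

Lemma sub_adjoin A I x : is_subring A -> I `<=` adjoin A I x.
Proof.
by move=> hA y Iy; exists y => //; exists 0; [exact: subring0|rewrite mulr0 addr0].
Qed.

Lemma mem_adjoin A I x : is_subring A -> submodule A I -> adjoin A I x x.
Proof.
move=> hA hI; exists 0; first exact: submod0 hI.
by exists 1; [exact: subring1 | rewrite mulr1 add0r].
Qed.

Lemma maximal_adjoin A M x : is_subring A -> maximal_ideal A M ->
  A x -> ~ M x -> exists a, A a /\ M (1 - x * a).
Proof.
move=> hA [hM _ Mmax] Ax nMx.
have [E|E] := Mmax _ (adjoin_ideal hA hM Ax) (sub_adjoin x hA).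
  by case: nMx; rewrite -E; apply: mem_adjoin => //; case: hM.
have [y My [a Aa Eya]] : adjoin A M x 1 by rewrite E; exact: subring1.
by exists a; split=> //; rewrite -Eya addrK.
Qed.

Lemma maximal_prime A M : is_subring A -> maximal_ideal A M -> prime_ideal A M.
Proof.
move=> hA hMm; have [hM nMA _] := hMm; split=> // x y Ax Ay Mxy.
have [|nMx] := pselect (M x); [by left | right].
have [a [Aa M1]] := maximal_adjoin hA hMm Ax nMx.
rewrite (_ : y = y * (1 - x * a) + a * (x * y)); last by ring.
by case: hM => hM _; apply: (submodD hM); apply: (submodM hM).
Qed.

Lemma prime_not1 A Q : is_subring A -> prime_ideal A Q -> ~ Q 1.
Proof. by move=> hA [hQ nQA _] Q1; apply: nQA; exact: ideal1. Qed.

(** Krull's lemma: an ideal that is maximal among those containing I and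
    avoiding the multiplicative set S is prime. *)
Lemma exists_prime A I S : is_subring A -> ideal A I ->
  S 1 -> S `<=` A -> (forall s t, S s -> S t -> S (s * t)) ->
  (forall s, S s -> ~ I s) ->
  exists Q, [/\ prime_ideal A Q, I `<=` Q & forall s, S s -> ~ Q s].
Proof.
move=> hA hI S1 SA SM SI.
pose good X := [/\ ideal A X, I `<=` X & forall s, S s -> ~ X s].
(* The empty chain has union set0, which must therefore be admitted. *)
have [C CP Ctot|Q [[Q0|gQ] Qmax]] := @Zorn_bigcup K (fun X => X = set0 \/ good X).
- have [[X [CX gX]]|nogood] := pselect (exists X, C X /\ good X); last first.
    left; rewrite bigcup0 // => X CX.
    by have [//|gX] := CP _ CX; case: nogood; exists X.
  have goodC Y y : C Y -> Y y -> good Y.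
    by move=> /CP[->|//].
  right; split; [split|..]; [split|..].
  + by exists X => //; have [[+ _] _ _] := gX; exact: submod0.
  + move=> x y [Y CY Yx] [Z CZ Zy].
    have [[[hY _] _ _] [[hZ _] _ _]] := (goodC _ _ CY Yx, goodC _ _ CZ Zy).
    have [YZ|ZY] := Ctot _ _ CY CZ.
      by exists Z => //; apply: (submodD hZ) => //; exact: YZ.
    by exists Y => //; apply: (submodD hY) => //; exact: ZY.
  + move=> a x Aa [Y CY Yx]; exists Y => //.
    by have [[hY _] _ _] := goodC _ _ CY Yx; exact: submodM hY _ _.
  + by move=> x [Y CY Yx]; have [[_ YA] _ _] := goodC _ _ CY Yx; exact: YA.
  + by move=> x Ix; exists X => //; have [_ IX _] := gX; exact: IX.
  by move=> s Ss [Y CY Ys]; have [_ _ /(_ _ Ss)] := goodC _ _ CY Ys; exact.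
- have gI : good I by split.
  case: (Qmax I); last by right.
  rewrite Q0; split; first exact: sub0set.
  by move=> /(_ 0); apply; case: hI => + _; exact: submod0.
have [hQ IQ QS] := gQ; exists Q; split=> //; split=> //.
  by move=> QA; apply: (QS 1) => //; rewrite QA; exact: subring1.
(* By maximality, enlarging Q by any x outside Q makes it meet S. *)
have meets x : A x -> ~ Q x -> exists2 s, S s & adjoin A Q x s.
  move=> Ax nQx; apply: contrapT => none.
  apply: (Qmax (adjoin A Q x)).
    split; first exact: sub_adjoin.
    by move=> /(_ x) h; apply: nQx; apply: h; apply: mem_adjoin => //; case: hQ.
  right; split; first exact: adjoin_ideal.
    by apply: subset_trans IQ _; exact: sub_adjoin.
  by move=> s Ss Qs; apply: none; exists s.
move=> x y Ax Ay Qxy; apply: contrapT => /not_orP[nQx nQy].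
have [s Ss [q Qq [a Aa Es]]] := meets _ Ax nQx.
have [t St [q' Qq' [b Ab Et]]] := meets _ Ay nQy.
apply: (QS (s * t)); first exact: SM.
have [hQm QA] := hQ.
rewrite -Es -Et.
rewrite (_ : _ * _ = (q' + y * b) * q + (x * a) * q' + a * b * (x * y)); last by ring.
have Aqyb : A (q' + y * b) by apply: subringD => //; [exact: QA|exact: subringM].
by apply: (submodD hQm); [apply: (submodD hQm)|]; apply: (submodM hQm) => //;
  exact: subringM.
Qed.

(** In the localization at a prime M minimal over I, the only prime above I is
    the maximal ideal, so each element of M is nilpotent modulo I there; s is
    the denominator to be cleared.  Otherwise the products s t ^ k would form a
    multiplicative set avoiding I, and [exists_prime] would give a prime
    strictly inside M. *)
Lemma minimal_prime_nilpotent A I M t : is_subring A -> ideal A I ->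
  prime_ideal A M ->
  (forall Q, prime_ideal A Q -> I `<=` Q -> Q `<=` M -> M `<=` Q) -> M t ->
  exists k s, [/\ A s, ~ M s & I (s * t ^+ k)].
Proof.
move=> hA hI hM Mmin Mt; have [[_ MA] _ MP] := hM; have At := MA _ Mt.
apply: contrapT => none.
pose S := [set x | exists k s, [/\ A s, ~ M s & x = s * t ^+ k]].
have M1 := prime_not1 hA hM.
have [||||Q [hQ IQ SQ]] := @exists_prime A I S hA hI.
- by exists 0%N, 1; split=> //; [exact: subring1 | rewrite expr0 mulr1].
- by move=> _ [k [s [As _ ->]]]; apply: subringM => //; exact: subringX.
- move=> _ _ [k [s [As Ms ->]]] [l [u [Au Mu ->]]].
  exists (k + l)%N, (s * u); split; [exact: subringM| |by rewrite exprD mulrACA].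
  by move/MP => /(_ As Au)[].
- by move=> _ [k [s [As Ms ->]]] Ist; apply: none; exists k, s.
have QM : Q `<=` M.
  move=> x Qx; apply: contrapT => Mx; apply: (SQ x) => //.
  exists 0%N, x; split=> //; last by rewrite expr0 mulr1.
  by case: hQ => -[_ QA] _ _; exact: QA.
apply: (SQ t); last exact: Mmin.
by exists 1%N, 1; split=> //; [exact: subring1 | rewrite expr1 mul1r].
Qed.

Lemma prime_over A I : is_subring A -> ideal A I -> ~ I 1 ->
  exists2 Q, prime_ideal A Q & I `<=` Q.
Proof.
move=> hA hI I1.
have [||||Q [hQ IQ _]] := @exists_prime A I [set 1] hA hI; last by exists Q.
- by [].
- by move=> _ ->; exact: subring1.
- by move=> _ _ -> ->; rewrite mulr1.
by move=> _ ->.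
Qed.

Definition comax I J : Prop := exists x y, [/\ I x, J y & x + y = 1].

Definition capI (T : eqType) B (r : seq T) (I : T -> set K) : set K :=
  [set x | B x /\ forall k, k \in r -> I k x].

Lemma capI_ideal (T : eqType) B (r : seq T) (I : T -> set K) : is_subring B ->
  (forall k, k \in r -> ideal B (I k)) -> ideal B (capI B r I).
Proof.
move=> hB hI; split; [split|by move=> x []].
- by split=> [|k /hI[+ _]]; [exact: subring0 | exact: submod0].
- move=> x y [Bx Ix] [By Iy]; split=> [|k kr]; first exact: subringD.
  by case: (hI k kr) => + _; move/submodD; apply; [exact: Ix | exact: Iy].
move=> a x Ba [Bx Ix]; split=> [|k kr]; first exact: subringM.
by case: (hI k kr) => + _; move/submodM; apply => //; exact: Ix.
Qed.

Lemma comax_maximal A M N : is_subring A -> maximal_ideal A M ->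
  maximal_ideal A N -> M <> N -> comax M N.
Proof.
move=> hA hMm hN nMN; have [[hM MA] nMA Mmax] := hMm; have [hNi _ Nmax] := hN.
have [MN|/existsNP[x /not_implyP[Mx nNx]]] := pselect (M `<=` N).
  have [E|E] := Mmax N hNi MN; first by case: nMN.
  by case: hN => _ /(_ E).
have [a [Aa N1]] := maximal_adjoin hA hN (MA _ Mx) nNx.
exists (x * a), (1 - x * a); split=> //; last by rewrite addrC subrK.
by rewrite mulrC; exact: submodM hM _ _.
Qed.

Lemma comax_capI (T : eqType) B (r : seq T) (I : T -> set K) J :
  is_subring B -> ideal B J -> (forall k, k \in r -> ideal B (I k)) ->
  (forall k, k \in r -> comax J (I k)) -> comax J (capI B r I).
Proof.
move=> hB [hJ JB]; elim: r => [|k r IHr] hI hJI.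
  exists 0, 1; split; [exact: submod0 hJ| |by rewrite add0r].
  by split=> //; exact: subring1.
have [||x [y [Jx [By Iy] Exy]]] := IHr.
- by move=> l lr; apply: hI; rewrite inE lr orbT.
- by move=> l lr; apply: hJI; rewrite inE lr orbT.
have [u [v [Ju Iv Euv]]] := hJI k (mem_head _ _).
have [hIk IkB] := hI k (mem_head _ _).
have Bv := IkB _ Iv.
exists (x + y * u), (y * v); split; last first.
- by rewrite -addrA -mulrDr Euv mulr1.
- split; first exact: subringM.
  move=> l; rewrite inE => /orP[/eqP->|lr]; first exact: submodM hIk _ _.
  rewrite mulrC; have [|hIl _] := hI l; first by rewrite inE lr orbT.
  by apply: (submodM hIl) => //; exact: Iy.
by apply: (submodD hJ) => //; exact: submodM hJ _ _.
Qed.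

Lemma mulM_comax B I J : ideal B I -> ideal B J -> comax I J ->
  mulM I J = I `&` J.
Proof.
move=> [hI IB] [hJ JB] [x [y [Ix Jy Exy]]]; apply/seteqP; split.
  move=> z IJz; split; move: z IJz.
    by apply: (mulM_le hI) => a b Ia /JB Bb; rewrite mulrC; exact: submodM hI _ _.
  by apply: (mulM_le hJ) => a b /IB Ba Jb; exact: submodM hJ _ _.
move=> z [Iz Jz]; rewrite -[z]mulr1 -Exy mulrDr; apply: mulMD.
  by rewrite mulrC; exact: mulM_prod.
exact: mulM_prod.
Qed.

(** Chinese remainder theorem.  It is stated for a family of ideals, not only
    of maximal ones, because it is used twice: for the maximal ideals over each
    p_i, and then for the resulting products. *)
Lemma prod_comax (T : eqType) B (r : seq T) (I : T -> set K) :
  is_subring B -> uniq r -> (forall k, k \in r -> ideal B (I k)) ->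
  {in r &, forall k l, k != l -> comax (I k) (I l)} ->
  \big[@mulM K/B]_(k <- r) I k = capI B r I.
Proof.
move=> hB; elim: r => [_ _ _|k r IHr /= /andP[kr ur] hI hII].
  by rewrite big_nil; apply/seteqP; split=> [x Bx|x []].
have hIr l : l \in r -> ideal B (I l) by move=> lr; apply: hI; rewrite inE lr orbT.
rewrite big_cons IHr //; last first.
  by move=> l m lr mr; apply: hII; rewrite inE ?lr ?mr orbT.
have hIk := hI k (mem_head _ _).
rewrite (mulM_comax hIk); [|exact: capI_ideal|]; last first.
  apply: comax_capI => // l lr; apply: hII; rewrite ?mem_head ?inE ?lr ?orbT //.
  by apply: contraNneq kr => ->.
apply/seteqP; split=> [x [Ix [Bx Irx]]|x [Bx Ix]].
  by split=> // l; rewrite inE => /orP[/eqP->|/Irx].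
split; first exact: Ix (mem_head _ _).
by split=> // l lr; apply: Ix; rewrite inE lr orbT.
Qed.

End Submodules.

Section Cosets.
Variable K : fieldType.
Implicit Types A I : set K.

Lemma coset_eqP A I x y : is_subring A -> submodule A I ->
  coset I x = coset I y <-> I (x - y).
Proof.
move=> hA hI; split=> [E|Ixy].
  have : coset I x x by exists 0; [exact: submod0 hI | rewrite addr0].
  by rewrite E => -[z Iz <-]; rewrite addrC addKr.
apply/seteqP; split=> _ [z Iz <-].
  exists (x - y + z); first exact: submodD hI _ _.
  by rewrite addrA [y + _]addrC subrK.
exists (z - (x - y)); first exact: (submodB hA hI).
by ring.
Qed.

Lemma quot_unitsP A I C : is_subring A -> ideal A I ->
  quot_units A I C <->
  exists x y, [/\ A x, A y, C = coset I x & I (x * y - 1)].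
Proof.
move=> hA hI; have [hIm _] := hI; split.
  move=> [[x Ax <-] [_ [y Ay <-]]]; rewrite (coset_mulE hI) // => E.
  by exists x, y; split=> //; apply/(coset_eqP _ _ hA hIm).
move=> [x [y [Ax Ay -> E]]]; split; first by exists x.
exists (coset I y); first by exists y.
by rewrite (coset_mulE hI) //; apply/(coset_eqP _ _ hA hIm).
Qed.

End Cosets.

(** * Conductor of a one-dimensional ring *)

(** The rings O and B below stand for the given ring and its normalization.
    Everything that is needed about integrality is contained in [B_integral]
    and [B_closed]: the first makes the primes of B over maximal ideals of O
    maximal, the second bounds the inverses of ideals. *)
Section Conductor.
Variables (K : fieldType) (O B : set K).
Hypotheses (hO : is_subring O) (hB : is_subring B) (OB : O `<=` B).
(* K is the field of fractions of O. *)
Hypothesis O_frac : forall x, exists d, [/\ O d, d != 0 & O (d * x)].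
Hypothesis O_noeth : noetherian O.
(* O has dimension one: at most one, and at least one. *)
Hypothesis O_dim_le1 : forall Q, prime_ideal O Q ->
  (exists2 x, Q x & x != 0) -> maximal_ideal O Q.
Hypothesis O_dim_ge1 : forall Q, maximal_ideal O Q -> exists2 x, Q x & x != 0.
(* The foldr is the value at x of the monic polynomial whose coefficients below
   the leading one are listed by l. *)
Hypothesis B_integral : forall x, B x -> exists2 l : seq K,
  (forall c, c \in l -> O c) & foldr (fun c y => y * x + c) 1 l = 0.
Hypothesis B_closed : forall x M, ideal O M -> (exists2 y, M y & y != 0) ->
  (forall y, M y -> M (x * y)) -> B x.

Let F := conductor O B.

Lemma conductor_ideal : ideal B F.
Proof.
split; [split|].
- by move=> y _; rewrite mul0r; exact: subring0.
- by move=> x y Fx Fy z Bz; rewrite mulrDl; apply: subringD; [|exact: Fx|exact: Fy].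
- by move=> b x Bb Fx z Bz; rewrite [b * x]mulrC -mulrA; apply: Fx; exact: subringM.
by move=> x Fx; apply: OB; rewrite -[x]mulr1; apply: Fx; exact: subring1.
Qed.

Lemma conductor_submod : submodule B F. Proof. by case: conductor_ideal. Qed.

Lemma conductor_sub : F `<=` O.
Proof. by move=> x Fx; rewrite -[x]mulr1; apply: Fx; exact: subring1. Qed.

Lemma conductor_idealO : ideal O F.
Proof.
by split; [exact: restrict_submod OB conductor_submod|exact: conductor_sub].
Qed.

Hypothesis F_neq0 : exists2 d, F d & d != 0.

Lemma contract_ideal J : ideal B J -> ideal O (J `&` O).
Proof.
move=> [hJ _]; split; [split|by move=> x []].
- by split; [exact: submod0 hJ | exact: subring0].
- by move=> x y [? ?] [? ?]; split; [exact: submodD hJ _ _ | exact: subringD].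
move=> a x Oa [Jx Ox]; split; last exact: subringM.
by apply: (submodM hJ) => //; exact: OB.
Qed.

Lemma contract_maximal Q : prime_ideal B Q -> F `<=` Q ->
  maximal_ideal O (Q `&` O).
Proof.
move=> hQ FQ; apply: O_dim_le1; last first.
  by have [d Fd d0] := F_neq0; exists d => //; split; [exact: FQ|exact: conductor_sub].
have [hQi _ QP] := hQ; split; first exact: contract_ideal.
  move=> E; apply: (prime_not1 hB hQ).
  by have [] : (Q `&` O) 1 by rewrite E; exact: subring1.
move=> x y Ox Oy [Qxy _].
by case: (QP x y (OB Ox) (OB Oy) Qxy) => ?; [left|right]; split.
Qed.

(** For x in an ideal I strictly above Q, divide a monic relation satisfied by
    x by x as long as its constant term c is in Q.  When c is not in Q, it is
    invertible modulo Q, because Q contracts to a maximal ideal; and c lies in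
    I, being a multiple of x modulo Q.  So 1 is in I. *)
Lemma prime_over_conductor_maximal Q : prime_ideal B Q -> F `<=` Q ->
  maximal_ideal B Q.
Proof.
move=> hQ FQ; have hp := contract_maximal hQ FQ; have [hQi nQ QP] := hQ.
have [hQm QB] := hQi.
split=> // I hI QI; have [hIm IB] := hI.
have [IQ|/existsNP[x /not_implyP[Ix nQx]]] := pselect (I `<=` Q).
  by left; apply/seteqP.
right; apply: ideal1 => //; have Bx := IB _ Ix.
suff main (l : seq K) : (forall c, c \in l -> O c) ->
    Q (foldr (fun c y => y * x + c) 1 l) -> I 1.
  have [l Ol E] := B_integral Bx; apply: (main l Ol).
  by rewrite E; exact: submod0 hQm.
elim: l => [_ /= /QI //|c l IHl Ol /=].
set y := foldr _ _ _ => Qy.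
have Oc : O c by apply: Ol; exact: mem_head.
have Ol' d : d \in l -> O d by move=> dl; apply: Ol; rewrite inE dl orbT.
have By : B y.
  rewrite /y; elim: (l) Ol' => [_ /=|d m IHm Om /=]; first exact: subring1.
  apply: subringD => //; last by apply/OB/Om; exact: mem_head.
  by apply: subringM => //; apply: IHm => e em; apply: Om; rewrite inE em orbT.
have [Qc|nQc] := pselect (Q c).
  apply: IHl => //; case: (QP y x) => //.
  by rewrite -[y * x](addrK c); exact: submodB hB hQm _ _.
have [|a [Oa [Q1 _]]] := maximal_adjoin hO hp Oc; first by case.
have Ic : I c.
  have -> : c = (y * x + c) - y * x by rewrite [_ + c]addrC addrK.
  by apply: (submodB hB hIm); [exact: QI | exact: submodM hIm _ _].
rewrite -[1](subrK (c * a)); apply: (submodD hIm); first exact: QI.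
by rewrite mulrC; apply: (submodM hIm) => //; exact: OB.
Qed.

(** Denominators come for free: a nonzero element of the inverse, multiplied
    into O, is one. *)
Lemma invertible_of_inverse M N : submodule O M -> submodule O N ->
  mulM M N = O -> inv_ideals O M.
Proof.
have frac M' N' : submodule O M' -> mulM M' N' = O -> fractional_ideal O M'.
  move=> hM E; split=> //.
  have [[n Nn n0]|N0] := pselect (exists2 n, N' n & n != 0); last first.
    have : mulM M' N' 1 by rewrite E; exact: subring1.
    suff sub0 : mulM M' N' `<=` [set 0] by move=> /sub0 /eqP; rewrite oner_eq0.
    apply: mulM_ind => [//|_ _ -> ->|x y _ Ny] /=; first by rewrite addr0.
    have [->|y0] := eqVneq y 0; first by rewrite mulr0.
    by case: N0; exists y.
  have [d [Od d0 Odn]] := O_frac n.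
  exists (d * n); split=> //; first by rewrite mulf_neq0.
  move=> x Mx; rewrite -mulrA; apply: subringM => //.
  by rewrite -E mulrC; exact: mulM_prod.
move=> hM hN E; split; first exact: frac E.
by exists N => //; apply: (@frac N M) => //; rewrite mulMC.
Qed.

(** Let N be an inverse of the contraction p.  As N F is a B-module contained
    in N p = O, it is contained in F, so N consists of integral elements and is
    contained in B.  Then 1 lies in p N, hence in Q. *)
Lemma contract_noninvertible Q : prime_ideal B Q -> F `<=` Q ->
  ~ inv_ideals O (Q `&` O).
Proof.
move=> hQ FQ [_ [N hN E]]; apply: (prime_not1 hB hQ).
have [[hQm _] _ _] := hQ.
have NB : N `<=` B.
  move=> n Nn; apply: (B_closed conductor_idealO F_neq0) => f Ff y By.
  rewrite -mulrA mulrC -E; apply: mulM_prod => //.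
  have Ffy : F (f * y) by rewrite mulrC; exact: submodM conductor_submod _ _.
  by split; [exact: FQ | exact: conductor_sub].
have sub : mulM (Q `&` O) N `<=` Q.
  apply: (mulM_le hQm) => q n [Qq _] /NB Bn; rewrite mulrC.
  exact: submodM hQm _ _.
by apply: sub; rewrite E; exact: subring1.
Qed.

(** The class of x in O / a O is a nonzero element killed by p.  Each generator
    of p is nilpotent modulo a O in the localization at p.  Starting from 1,
    which is nonzero there, multiply by each generator in turn to the highest
    power that keeps the class nonzero; what results is killed by all the
    generators, and s clears the denominators. *)
Lemma colon_witness p a : maximal_ideal O p -> p a -> a != 0 ->
  exists x, [/\ O x, ~ principal O a x & forall t, p t -> principal O a (x * t)].
Proof.
move=> hp pa a0; have [[hpm pO] _ _] := hp.
have hpp := maximal_prime hO hp; have [_ _ pP] := hpp.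
have Oa := pO _ pa.
have hJm : submodule O (principal O a) by exact/scale_submod/subring_submod.
have hJ : ideal O (principal O a).
  by split=> // _ [o Oo <-]; exact: subringM.
have pmin Q : prime_ideal O Q -> principal O a `<=` Q -> Q `<=` p -> p `<=` Q.
  move=> hQ aQ Qp; have [|_ _ Qmax] := O_dim_le1 hQ.
    by exists a => //; apply: aQ; exists 1; rewrite ?mulr1 //; exact: subring1.
  have [hpi _ _] := hp.
  by have [->|E] := Qmax p hpi Qp => //; case: hpp => _ /(_ E).
have step (l : seq K) : (forall t, t \in l -> p t) ->
    exists x, [/\ O x, (forall s, O s -> ~ p s -> ~ principal O a (s * x))
      & exists s, [/\ O s, ~ p s
          & forall t, t \in l -> principal O a (s * x * t)]].
  elim: l => [_|t l IHl pl].
    exists 1; split; first exact: subring1.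
      by move=> s Os ps [o Oo E]; apply: ps; rewrite -[s]mulr1 -E mulrC;
        exact: submodM hpm _ _.
    by exists 1; split=> //; [exact: subring1|exact: prime_not1 hpp].
  have [|x [Ox Jx [s [Os ps Jsx]]]] := IHl.
    by move=> u ul; apply: pl; rewrite inE ul orbT.
  have pt : p t by apply: pl; exact: mem_head.
  have Ot := pO _ pt.
  pose kills k := `[< exists u, [/\ O u, ~ p u & principal O a (u * x * t ^+ k)] >].
  have exk : exists k, kills k.
    have [k [u [Ou pu Ju]]] := minimal_prime_nilpotent hO hJ hpp pmin pt.
    exists k; apply/asboolP; exists u; split=> //.
    by rewrite mulrAC mulrC; exact: submodM hJm _ _.
  case: (ex_minnP exk) => k /asboolP[u [Ou pu Ju]] kmin.
  case: k => [|k] in Ju kmin *.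
    by case: (Jx u) => //; rewrite -[_ * x]mulr1 -(expr0 t).
  have Otk := subringX k hO Ot.
  exists (x * t ^+ k); split; first exact: subringM.
    move=> v Ov pv Jv; have /kmin : kills k; last by rewrite ltnn.
    by apply/asboolP; exists v; split=> //; rewrite -mulrA.
  exists (s * u); split; first exact: subringM.
    by move/pP => /(_ Os Ou)[].
  move=> v; rewrite inE => /orP[/eqP->|vl].
    rewrite (_ : _ * t = s * (u * x * t ^+ k.+1)); last by rewrite exprS; ring.
    exact: submodM hJm _ _.
  rewrite (_ : _ * v = (u * t ^+ k) * (s * x * v)); last by ring.
  by apply: (submodM hJm); [exact: subringM | exact: Jsx].
have [hpi _ _] := hp; have [l El] := O_noeth hpi.
have [|x [Ox Jx [s [Os ps Jsx]]]] := step l.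
  by move=> t tl; rewrite El; exact: mem_span.
exists (s * x); split; [exact: subringM | exact: Jx |] => t.
rewrite El; move: t; apply: (@span_le _ O) => //.
split=> /= [|t u Jt Ju|b t Ob Jt].
- by rewrite mulr0; exact: submod0 hJm.
- by rewrite mulrDr; exact: submodD hJm _ _.
by rewrite mulrCA; exact: submodM hJm _ _.
Qed.

(** Let N = (O : p).  If p were not invertible, then p N = p, so N would be
    contained in B.  As p + F = O and F N, like p N, is contained in O, this
    forces N = O, but [colon_witness] gives an element x / a of N outside O. *)
Lemma maximal_invertible p : maximal_ideal O p -> ~ F `<=` p -> inv_ideals O p.
Proof.
move=> hp nFp; have [[hpm pO] npO pmax] := hp.
have [a pa a0] := O_dim_ge1 hp; have Oa := pO _ pa.
pose N := [set x | forall y, p y -> O (x * y)].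
have hN : submodule O N.
  split=> [y _|x y Nx Ny z pz|b x Ob Nx z pz].
  - by rewrite mul0r; exact: subring0.
  - by rewrite mulrDl; apply: subringD; [|exact: Nx|exact: Ny].
  by rewrite -mulrA; apply: subringM => //; exact: Nx.
have pNO : mulM p N `<=` O.
  by apply: (mulM_le (subring_submod hO)) => x y px Ny; rewrite mulrC; exact: Ny.
have ppN : p `<=` mulM p N.
  move=> x px; rewrite -[x]mulr1; apply: mulM_prod => // y py.
  by rewrite mul1r; exact: pO.
have [|E|] := pmax (mulM p N) _ ppN; first by split=> //; exact: mulM_submod.
  have [x [Ox nax apx]] := colon_witness hp pa a0.
  case: nax; exists (x / a); last by rewrite mulrC divfK.
  have Nxa : N (x / a).
    move=> t pt; have [o Oo Eo] := apx t pt.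
    by rewrite mulrAC -Eo mulrAC mulfV // mul1r.
  have Bxa : B (x / a).
    apply: (B_closed (M := p)) => //; first by exists a.
    by move=> y py; rewrite -E mulrC; exact: mulM_prod.
  have [f [Ff nf]] : exists f, F f /\ ~ p f.
    apply: contrapT => h; apply: nFp => f Ff; apply: contrapT => nf.
    by apply: h; exists f.
  have [b [Ob p1]] := maximal_adjoin hO hp (conductor_sub Ff) nf.
  rewrite -[x / a]mulr1 -[1](subrK (f * b)) mulrDr; apply: subringD => //.
    exact: Nxa.
  by rewrite mulrA; apply: subringM => //; rewrite mulrC; exact: Ff.
exact: invertible_of_inverse.
Qed.

(** B / F is zero-dimensional.  Let I consist of the x with t ^ n x in F for
    some n.  A prime M above I and t would be minimal over F, and
    [minimal_prime_nilpotent] would give an element of I outside M.  So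
    I + t B = B. *)
Lemma pi_regular t : B t ->
  exists b n, B b /\ F (t ^+ n * (1 - t * b)).
Proof.
move=> Bt; have [hFm FB] := conductor_ideal.
pose I := [set x | B x /\ exists n, F (t ^+ n * x)].
have hI : ideal B I.
  split; [split|by move=> x []].
  - by split; [exact: subring0|exists 0%N; rewrite mulr0; exact: submod0 hFm].
  - move=> x y [Bx [n Fx]] [By [m Fy]]; split; first exact: subringD.
    exists (m + n)%N; rewrite mulrDr; apply: (submodD hFm).
      by rewrite exprD -mulrA; apply: (submodM hFm) => //; exact: subringX.
    by rewrite addnC exprD -mulrA; apply: (submodM hFm) => //; exact: subringX.
  move=> b x Bb [Bx [n Fx]]; split; first exact: subringM.
  by exists n; rewrite mulrCA; exact: submodM hFm _ _.
have FI : F `<=` I.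
  by move=> f Ff; split; [exact: FB | exists 0%N; rewrite expr0 mul1r].
have hIt := adjoin_ideal hB hI Bt.
have [[y [By [n Fy]] [b Bb Eyb]]|nIt1] := pselect (adjoin B I t 1).
  by exists b, n; split=> //; rewrite -Eyb addrK.
have [M hM IM] := prime_over hB hIt nIt1.
have Mt : M t by apply: IM; apply: mem_adjoin => //; case: hI.
have Mmin Q : prime_ideal B Q -> F `<=` Q -> Q `<=` M -> M `<=` Q.
  move=> hQ FQ QM; have [_ _ Qmax] := prime_over_conductor_maximal hQ FQ.
  have [hMi nM _] := hM.
  by have [->|//] := Qmax _ hMi QM.
have [k [s [Bs Ms Fs]]] := minimal_prime_nilpotent hB conductor_ideal hM Mmin Mt.
case: Ms; apply: IM; apply: sub_adjoin => //; split=> //.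
by exists k; rewrite mulrC.
Qed.

Definition boolean_mod_conductor := forall x, B x -> F (x ^+ 2 - x).

(** * When the units modulo the conductor come from the small ring *)

Section UnitsDescend.

Hypothesis units_descend :
  forall u v, B u -> B v -> F (u * v - 1) -> O u.

(** If y ^ 2 is in F, then 1 + y b is a unit modulo F with inverse 1 - y b, so
    y b lies in O for every b in B. *)
Lemma conductor_radical x n : B x -> F (x ^+ n) -> F x.
Proof.
have [hFm FB] := conductor_ideal.
have sqr y : B y -> F (y ^+ 2) -> F y.
  move=> By Fy b Bb; have Byb : B (y * b) by exact: subringM.
  rewrite (_ : y * b = (1 + y * b) - 1); last by ring.
  apply: subringB => //; last exact: subring1.
  apply: (units_descend (v := 1 - y * b)).
  - by apply: subringD => //; exact: subring1.
  - by apply: subringB => //; exact: subring1.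
  rewrite (_ : _ - 1 = (- b ^+ 2) * y ^+ 2); last by ring.
  by apply: (submodM hFm) => //; apply: subringN => //; exact: subringX.
(* The square of x ^ n.+1 is divisible by x ^ n.+2. *)
move=> Bx; elim: n => [|[|n] IHn].
- by rewrite expr0 => F1; rewrite -[x]mulr1; exact: submodM hFm _ _.
- by rewrite expr1.
move=> Fx; apply: IHn; apply: sqr; first exact: subringX.
rewrite (_ : _ ^+ 2 = x ^+ n * x ^+ n.+2); last by rewrite !exprS; ring.
by apply: (submodM hFm) => //; exact: subringX.
Qed.

Lemma von_neumann_regular t : B t -> exists2 b, B b & F (t * (1 - t * b)).
Proof.
have [hFm FB] := conductor_ideal.
move=> Bt; have [b [n [Bb Fb]]] := pi_regular Bt; exists b => //.
have B1 : B (1 - t * b) by apply: subringB; [|exact: subring1|exact: subringM].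
apply: (@conductor_radical _ n.+1); first exact: subringM.
rewrite (_ : _ ^+ n.+1 = t * (1 - t * b) ^+ n * (t ^+ n * (1 - t * b))).
  by apply: (submodM hFm) => //; apply: subringM => //; exact: subringX.
by rewrite exprMn !exprS; ring.
Qed.

(** If t = t ^ 2 b, then e = t b is idempotent and t = e (t + 1 - e), where
    t + 1 - e has the inverse e b + 1 - e. *)
Lemma idempotent_times_unit t : B t -> exists e w w',
  [/\ B e, B w, B w', F (w * w' - 1) & F (e ^+ 2 - e) /\ F (t - e * w)].
Proof.
have [hFm FB] := conductor_ideal; move=> Bt.
have [b Bb Ft] := von_neumann_regular Bt.
have Btb : B (t * b) by exact: subringM.
have B1 : B 1 by exact: subring1.
have B1e : B (1 - t * b) by exact: subringB.
have FtM z y : B z -> y = z * (t * (1 - t * b)) -> F y.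
  by move=> Bz ->; exact: submodM hFm _ _.
have B1b : B (1 - b) by exact: subringB.
exists (t * b), (t + (1 - t * b)), (t * b * b + (1 - t * b)).
split=> //; [exact: subringD|by apply: subringD => //; exact: subringM| |split].
- by apply: (FtM ((1 - b) ^+ 2)); [exact: subringX | ring].
- by apply: (FtM (- b)); [exact: subringN | ring].
by apply: (FtM (1 - b)); [|ring].
Qed.

(** Write t = e w modulo F with e idempotent and w a unit.  Then (u - 1) t is
    (e u + 1 - e) w - w, a difference of two units, hence in O for all t. *)
Lemma units_trivial_mod_conductor u v : B u -> B v -> F (u * v - 1) -> F (u - 1).
Proof.
have [hFm FB] := conductor_ideal; move=> Bu Bv Fuv t Bt.
have B1 : B 1 by exact: subring1.
have [e [w [w' [Be Bw Bw' Fw [Fe Ft]]]]] := idempotent_times_unit Bt.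
have Beu : B (e * u + (1 - e)).
  by apply: subringD => //; [exact: subringM | exact: subringB].
rewrite (_ : _ * t = (u - 1) * (t - e * w) + ((e * u + (1 - e)) * w - w)); last by ring.
apply: subringD => //.
  by apply: conductor_sub; apply: (submodM hFm) => //; exact: subringB.
apply: subringB => //; last exact: units_descend Fw.
apply: (units_descend (v := (e * v + (1 - e)) * w')).
- exact: subringM.
- by apply: subringM => //; apply: subringD => //; [exact: subringM | exact: subringB].
rewrite (_ : _ - 1 =
    ((e * u + (1 - e)) * (e * v + (1 - e))) * (w * w' - 1)
    + (e * e * (u * v - 1) + (2%:R - u - v) * (e ^+ 2 - e))); last by ring.
have Bev : B (e * v + (1 - e)).
  by apply: subringD => //; [exact: subringM | exact: subringB].
apply: (submodD hFm); first by apply: (submodM hFm) => //; exact: subringM.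
apply: (submodD hFm); apply: (submodM hFm) => //; first exact: subringM.
by apply: subringB => //; apply: subringB => //; exact: subringD.
Qed.

Lemma boolean_of_units_descend : boolean_mod_conductor.
Proof.
have [hFm FB] := conductor_ideal; move=> t Bt.
have [e [w [w' [Be Bw Bw' Fw [Fe Ft]]]]] := idempotent_times_unit Bt.
have Fw1 := units_trivial_mod_conductor Bw Bw' Fw.
have Fte : F (t - e).
  rewrite (_ : t - e = (t - e * w) + e * (w - 1)); last by ring.
  by apply: (submodD hFm) => //; exact: submodM hFm _ _.
rewrite (_ : _ - t = (t + e - 1) * (t - e) + (e ^+ 2 - e)); last by ring.
apply: (submodD hFm) => //; apply: (submodM hFm) => //.
by apply: subringB => //; [exact: subringD | exact: subring1].
Qed.

End UnitsDescend.

(** * Injectivity of the extension maps *)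

(** It is enough that an invertible c with c B = B equals O.  From F = F c and
    x = x ^ 2 - (x ^ 2 - x) one gets that c is contained in c ^ 2, so O is
    contained in c; by symmetry O is contained in the inverse of c too. *)
Lemma extension_injective :
  boolean_mod_conductor -> set_inj (inv_ideals O) (extension B).
Proof.
have [hFm FB] := conductor_ideal; have O1 := subring1 hO.
have idO M : submodule O M -> mulM M O = M by exact: mulM_id.
have idF : mulM F B = F by apply: mulM_id => //; exact: subring1.
move=> hbool M N /set_mem[[hM _] [M' [hM' _] EM]] /set_mem[[hN _] [N' [hN' _] EN]].
rewrite /extension => E.
have hBO : submodule O B by exact: restrict_submod OB (subring_submod hB).
have contains1 L L' : submodule O L -> mulM L L' = O -> mulM L B = B -> O `<=` L.
  move=> hL ELL' ELB; have LB : L `<=` B.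
    by move=> x Lx; rewrite -ELB -[x]mulr1; apply: mulM_prod => //; exact: subring1.
  have ELF : mulM L F = F by rewrite -idF mulMC -mulMA [mulM B L]mulMC ELB.
  have hLL : submodule O (mulM L L) by exact: mulM_submod.
  have FLL : F `<=` mulM L L.
    by rewrite -{1}ELF -ELF mulMA -[X in _ `<=` X]idO //; apply: mulMS => //;
      exact: conductor_sub.
  have LLL : L `<=` mulM L L.
    move=> x Lx; rewrite (_ : x = x * x - (x ^+ 2 - x)); last by ring.
    apply: (submodB hO hLL); first exact: mulM_prod.
    by apply/FLL/hbool/LB.
  by rewrite -{1}ELL' -[X in _ `<=` X]idO // -ELL' mulMA; exact: mulMS.
(* c and c' are M / N and N / M. *)
pose c := mulM M N'; pose c' := mulM N M'.
have hc : submodule O c by exact: mulM_submod.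
have hc' : submodule O c' by exact: mulM_submod.
have Ecc' : mulM c c' = O.
  rewrite /c /c' [mulM N M']mulMC mulMA -[mulM (mulM M N') M']mulMA [mulM N' M']mulMC.
  by rewrite mulMA EM -mulMA [mulM N' N]mulMC EN idO //; exact: subring_submod.
have EcB : mulM c B = B.
  by rewrite /c [mulM M N']mulMC -mulMA E mulMA [mulM N' N]mulMC EN mulMC idO.
have Ec'B : mulM c' B = B.
  by rewrite /c' [mulM N M']mulMC -mulMA -E mulMA [mulM M' M]mulMC EM mulMC idO.
have Ec : c = O.
  apply/seteqP; split; last exact: contains1 Ecc' EcB.
  rewrite -{1}(idO c) // -Ecc'; apply: mulMS => //.
  by rewrite Ecc'; apply: (contains1 _ c) => //; rewrite mulMC.
by rewrite -(idO M) // -EN [mulM N N']mulMC mulMA -/c Ec mulMC idO.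
Qed.

Lemma principal_submod c : submodule O (principal O c).
Proof. by apply: scale_submod; exact: subring_submod. Qed.

Lemma mem_principal c : principal O c c.
Proof. by exists 1; rewrite ?mulr1 //; exact: subring1. Qed.

Lemma principalM c d : mulM (principal O c) (principal O d) = principal O (c * d).
Proof.
rewrite mul_principal; [|exact: subring1|exact: principal_submod].
apply/seteqP; split=> [_ [_ [x Ox <-] <-]|_ [x Ox <-]].
  by exists x => //; rewrite mulrA.
by exists (d * x); [exists x | rewrite mulrA].
Qed.

Lemma principal1 : principal O 1 = O.
Proof.
apply/seteqP; split=> [_ [x Ox <-]|x Ox]; first by rewrite mul1r.
by exists x; rewrite ?mul1r.
Qed.

Lemma scale_invertible c M : c != 0 -> inv_ideals O M ->
  inv_ideals O (mulM (principal O c) M).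
Proof.
move=> c0 [[hM _] [N [hN _] E]]; have hp := principal_submod.
apply: (@invertible_of_inverse _ (mulM (principal O c^-1) N)); [exact: mulM_submod..|].
rewrite -mulMA [mulM _ N]mulMC [mulM M _]mulMA E mulMA.
rewrite [mulM _ O]mulM_id //; last exact: subring1.
by rewrite principalM mulfV // principal1.
Qed.

Lemma ring_invertible : inv_ideals O O.
Proof.
apply: (@invertible_of_inverse _ O); [exact: subring_submod..|].
by rewrite mulM_id //; [exact: subring1 | exact: subring_submod].
Qed.

Lemma extension_principal u : units B u -> extension B (principal O u) = B.
Proof.
move=> [Bu [v Bv uv]]; apply/seteqP; split.
  apply: (mulM_le (subring_submod hB)) => _ b [x Ox <-] Bb.
  by apply: subringM => //; apply: subringM => //; exact: OB.
move=> x Bx; rewrite -[x]mul1r -uv -mulrA; apply: mulM_prod; last exact: subringM.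
exact: mem_principal.
Qed.

Lemma mem_pic_class M : submodule O M -> pic_class O M M.
Proof.
move=> hM; exists 1; first exact: oner_neq0.
by rewrite principal1 mulMC mulM_id //; exact: subring1.
Qed.

Lemma pic_class_scale c M : c != 0 ->
  pic_class O (mulM (principal O c) M) = pic_class O M.
Proof.
move=> c0; apply/seteqP; split=> _ [d /= d0 <-].
  exists (d * c); first by rewrite /= mulf_neq0.
  by rewrite mulMA principalM.
exists (d / c); first by rewrite /= mulf_neq0 ?invr_eq0.
by rewrite mulMA principalM divfK.
Qed.

Lemma pic_extension_injective : set_inj (inv_ideals O) (extension B) ->
  set_inj (Pic O) (pic_extension B) /\ units B = units O.
Proof.
move=> inj; split.
  move=> _ _ /set_mem[M IM <-] /set_mem[N IN <-] E.
  have : pic_extension B (pic_class O M) (extension B M).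
    by exists M => //; apply: mem_pic_class; case: IM => -[].
  rewrite E => -[_ [c c0 <-]] EMN; have {}c0 : c != 0 by exact: c0.
  have <- : mulM (principal O c) N = M.
    by apply: inj => //; apply: mem_set => //; exact: scale_invertible.
  exact: pic_class_scale.
apply/seteqP; split=> [u hu|u [Ou [v Ov uv]]]; last first.
  by split; [exact: OB | exists v => //; exact: OB].
have u0 : u != 0.
  by apply/eqP=> u0; case: hu => _ [v _ /eqP]; rewrite u0 mul0r eq_sym oner_eq0.
have EO : principal O u = O.
  apply: inj.
  - apply: mem_set; rewrite -[principal O u](mulM_id (subring1 hO)).
      exact: scale_invertible ring_invertible.
    exact: principal_submod.
  - exact: mem_set ring_invertible.
  rewrite extension_principal // /extension mulMC mulM_id //; first exact: subring1.
  exact: restrict_submod OB (subring_submod hB).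
have Ou : O u by rewrite -EO; exact: mem_principal.
split=> //; have : O 1 by exact: subring1.
by rewrite -{1}EO => -[v Ov uv]; exists v.
Qed.

(** The lattice attached to a unit u of B / F is [adjoin O F u] = u O + F.  The
    product contains F because f = u (v f) - (u v - 1) f with v f and f in F,
    and then it contains 1 = u v - (u v - 1). *)
Lemma unit_lattice_inverse u v : B u -> B v -> F (u * v - 1) ->
  mulM (adjoin O F u) (adjoin O F v) = O.
Proof.
have [hFm FB] := conductor_ideal; have [hFO FO] := conductor_idealO.
move=> Bu Bv Fuv; have O1 := subring1 hO.
have Ouv : O (u * v) by rewrite -[u * v](subrK 1); apply: subringD => //; exact: FO.
apply/seteqP; split.
  apply: (mulM_le (subring_submod hO)) => _ _ [f Ff [a Oa <-]] [g Fg [b Ob <-]].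
  rewrite (_ : _ * _ = (g + v * b) * f + (u * a) * g + a * b * (u * v)); last by ring.
  have Ba := OB Oa; have Bb := OB Ob.
  apply: subringD => //; last by apply: subringM => //; exact: subringM.
  apply: FO; apply: (submodD hFm); apply: (submodM hFm) => //; last exact: subringM.
  by apply: subringD => //; [exact: FB | exact: subringM].
have hP : submodule O (mulM (adjoin O F u) (adjoin O F v)).
  by apply: mulM_submod; exact: adjoin_submod.
have Pu := mem_adjoin u hO hFO; have Pv := mem_adjoin v hO hFO.
have FP : F `<=` mulM (adjoin O F u) (adjoin O F v).
  move=> f Ff.
  rewrite (_ : f = u * (v * f) - (u * v - 1) * f); last by ring.
  apply: (submodB hO hP); apply: mulM_prod => //; apply: sub_adjoin => //.
  exact: submodM hFm _ _.
have P1 : mulM (adjoin O F u) (adjoin O F v) 1.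
  rewrite (_ : 1 = u * v - (u * v - 1)); last by ring.
  by apply: (submodB hO hP); [exact: mulM_prod | exact: FP].
by move=> x Ox; rewrite -[x]mulr1; exact: submodM hP _ _.
Qed.

(** The lattice u O + F becomes trivial in B, so it is c O with c a unit of B,
    that is, a unit of O; and it contains u. *)
Lemma units_descend_of_pic : set_inj (Pic O) (pic_extension B) ->
  units B = units O -> forall u v, B u -> B v -> F (u * v - 1) -> O u.
Proof.
move=> inj Eunits u v Bu Bv Fuv.
have [hFm FB] := conductor_ideal; have [hFO FO] := conductor_idealO.
have O1 := subring1 hO; have B1 := subring1 hB.
pose a := adjoin O F u; have ha : submodule O a by exact: adjoin_submod.
have BM x y : B x -> B y -> B (x * y) by exact: subringM.
have hBO : submodule O B by exact: restrict_submod OB (subring_submod hB).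
have EaB : extension B a = B.
  have aB : a `<=` B.
    move=> _ [f Ff [x Ox <-]]; apply: subringD => //; first exact: FB.
    by apply: subringM => //; exact: OB.
  apply/seteqP; split.
    by apply: (mulM_le (subring_submod hB)) => x y /aB; exact: subringM.
  move=> x Bx; rewrite (_ : x = u * (v * x) - (u * v - 1) * x); last by ring.
  have hE : submodule O (extension B a) by exact: mulM_submod.
  apply: (submodB hO hE); apply: mulM_prod => //; last exact: sub_adjoin.
    exact: mem_adjoin.
  exact: subringM.
have Ea : pic_class O a = pic_class O O.
  apply: inj.
  - apply: mem_set; exists a => //.
    apply: (invertible_of_inverse (N := adjoin O F v)) => //.
      exact: adjoin_submod.
    exact: unit_lattice_inverse.
  - by apply: mem_set; exists O => //; exact: ring_invertible.
  rewrite !pic_extension_class // EaB; congr pic_class.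
  by rewrite /extension mulMC mulM_id.
have : pic_class O O a by rewrite -Ea; exact: mem_pic_class.
move=> [c c0]; rewrite mulM_id //; last exact: principal_submod.
move=> Eca; have au : a u by exact: mem_adjoin.
have uc : units B c.
  move: EaB; rewrite -Eca /extension => EcB; split.
    by rewrite -EcB; have := mulM_prod (mem_principal c) B1; rewrite mulr1.
  have [h hc] : exists2 y, B y & c * y = 1; last by exists h.
  move: (B1); rewrite -{1}EcB; move: (1 : K).
  apply: mulM_ind => [|_ _ [x Bx <-] [y By <-]|_ y [x Ox <-] By].
  - by exists 0; [exact: subring0 | rewrite mulr0].
  - by exists (x + y); [exact: subringD | rewrite mulrDr].
  by exists (x * y); [apply: subringM => //; exact: OB | rewrite mulrA].
move: uc; rewrite Eunits => -[Oc _].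
by move: au; rewrite -Eca => -[x Ox <-]; exact: subringM.
Qed.

(** * The maximal ideals over the conductor *)

Section Indexed.

Variables (r : nat) (p : 'I_r -> set K).
Hypothesis p_bij : set_bij [set: 'I_r] (noninvertible_maximal O) p.
Variables (s : 'I_r -> nat) (P : forall i : 'I_r, 'I_(s i) -> set K).
Arguments P : clear implicits.
Hypothesis P_bij : forall i, set_bij [set: 'I_(s i)] (maximal_over O B (p i)) (P i).

Lemma index_maximal i : maximal_ideal O (p i).
Proof. by case: p_bij => /(_ i I)[]. Qed.

Lemma index_noninvertible i : ~ inv_ideals O (p i).
Proof. by case: p_bij => /(_ i I)[]. Qed.

Lemma index_inj i j : p i = p j -> i = j.
Proof. by case: p_bij => _ + _; apply; rewrite in_setT. Qed.

Lemma conductor_sub_index i : F `<=` p i.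
Proof.
apply: contrapT => nF; apply: (@index_noninvertible i).
exact: maximal_invertible (index_maximal i) nF.
Qed.

Lemma over_maximal i j : maximal_ideal B (P i j).
Proof. by case: (P_bij i) => /(_ j I)[]. Qed.

Lemma over_contract i j : P i j `&` O = p i.
Proof. by case: (P_bij i) => /(_ j I)[]. Qed.

Lemma over_inj i j k : P i j = P i k -> j = k.
Proof. by case: (P_bij i) => _ + _; apply; rewrite in_setT. Qed.

Lemma sub_over i j : p i `<=` P i j.
Proof. by rewrite -(over_contract j) => x []. Qed.

Lemma conductor_sub_over i j : F `<=` P i j.
Proof. by apply: subset_trans (@sub_over i j); exact: conductor_sub_index. Qed.

Lemma over_surj Q : prime_ideal B Q -> F `<=` Q -> exists i j, Q = P i j.
Proof.
move=> hQ FQ; have [_ _ /(_ (Q `&` O))[]] := p_bij.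
  by split; [exact: contract_maximal | exact: contract_noninvertible].
move=> i _ Ei; have [_ _ /(_ Q)[]] := P_bij i.
  by split; [exact: prime_over_conductor_maximal | rewrite Ei].
by move=> j _ <-; exists i, j.
Qed.

Let prime_part i := \big[@mulM K/B]_(j < s i) P i j.

Lemma over_idealB i j : ideal B (P i j). Proof. by case: (over_maximal j). Qed.

Lemma prime_part_cap i : prime_part i = capI B (index_enum 'I_(s i)) (P i).
Proof.
apply: prod_comax => //; first exact: index_enum_uniq.
  by move=> j _; exact: over_idealB.
move=> j k _ _ jk; apply: (comax_maximal hB); [exact: over_maximal..|].
by move=> /over_inj /eqP; apply/negP.
Qed.

Lemma product_cap :
  \big[@mulM K/B]_(i < r) prime_part i = [set x | B x /\ forall i j, P i j x].
Proof.
have Ecap : \big[@mulM K/B]_(i < r) prime_part i = capI B (index_enum 'I_r) prime_part.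
  have hPP i : ideal B (prime_part i).
    by rewrite prime_part_cap; apply: capI_ideal => // j _; exact: over_idealB.
  apply: prod_comax => //; first exact: index_enum_uniq.
  move=> i k _ _ ik; rewrite [X in comax _ X]prime_part_cap.
  apply: comax_capI => // [j _|j _]; first exact: over_idealB.
  have comaxC I J : comax I J -> comax J I.
    by move=> [x [y [Ix Jy xy]]]; exists y, x; rewrite addrC.
  apply: comaxC; rewrite prime_part_cap.
  apply: comax_capI => // [|l _|l _]; [exact: over_idealB..|].
  apply: (comax_maximal hB); [exact: over_maximal..|] => E.
  by move/eqP: ik; apply; apply: index_inj; rewrite -(over_contract l) -E over_contract.
rewrite Ecap; apply/seteqP; split=> x [Bx Px]; split=> // i.
  move=> j; have := Px i (mem_index_enum _); rewrite prime_part_cap => -[_]; apply.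
  exact: mem_index_enum.
by move=> _; rewrite prime_part_cap; split=> // j _; exact: Px.
Qed.

Section Boolean.
Hypothesis hbool : boolean_mod_conductor.

(** If x lies in every P i j but 1 is not in J = (F : x), then a prime above J
    is one of the P i j, hence contains x; and it contains 1 - x, because
    (1 - x) x is in F. *)
Lemma conductor_cap : F = [set x | B x /\ forall i j, P i j x].
Proof.
have [hFm FB] := conductor_ideal; have B1 := subring1 hB.
apply/seteqP; split=> [x Fx|x [Bx Px]].
  by split; [exact: FB | move=> i j; exact: conductor_sub_over].
pose J := [set y | B y /\ F (y * x)].
have hJ : ideal B J.
  split; [split|by move=> y []].
  - by split; [exact: subring0 | rewrite mul0r; exact: submod0 hFm].
  - move=> y z [By Fy] [Bz Fz]; split; first exact: subringD.
    by rewrite mulrDl; exact: submodD hFm _ _.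
  move=> b y Bb [By Fy]; split; first exact: subringM.
  by rewrite -mulrA; exact: submodM hFm _ _.
have [[_]|nJ1] := pselect (J 1); first by rewrite mul1r.
have [Q hQ JQ] := prime_over hB hJ nJ1.
have FQ : F `<=` Q.
  move=> f Ff; apply: JQ; split; first exact: FB.
  by rewrite mulrC; exact: submodM hFm _ _.
have [i [j EQ]] := over_surj hQ FQ; case: (prime_not1 hB hQ).
have [[hQm _] _ _] := hQ.
rewrite -[1](subrK x); apply: (submodD hQm); last by rewrite EQ; exact: Px.
apply: JQ; split; first exact: subringB.
rewrite (_ : _ * x = (- 1) * (x ^+ 2 - x)); last by ring.
by apply: (submodM hFm); [exact: subringN | exact: hbool].
Qed.

Lemma residue_two i j x : B x -> P i j x \/ P i j (x - 1).
Proof.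
move=> Bx; have [_ _ PM] := maximal_prime hB (over_maximal j).
apply: PM => //; first by apply: subringB => //; exact: subring1.
rewrite (_ : _ * _ = x ^+ 2 - x); last by ring.
exact/conductor_sub_over/hbool.
Qed.

(** Take o in O outside p_i but in all the other p_k.  If there is at most one
    maximal ideal over p_i, then o b, for b in B, lies in every P k l, or else
    o b - o does, since both residues are 1 in the two-element field at the
    only place where they can be nonzero.  By [conductor_cap] o b is then in
    O, so that o is in F, which is contained in p_i. *)
Lemma at_least_two_over i : (2 <= s i)%N.
Proof.
have [hFm FB] := conductor_ideal; have B1 := subring1 hB.
rewrite leqNgt; apply/negP => si1.
have one j k : j = k :> 'I_(s i).
  by apply/val_inj; case: j k => j ? [k ?] /=; lia.
have [hpi pO] : ideal O (p i) by case: (index_maximal i).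
have [y [o [py [Oo po] yo]]] : comax (p i) (capI O (filter (predC1 i) (enum 'I_r)) p).
  apply: comax_capI => // k; rewrite mem_filter => /andP[/= ki _].
    by case: (index_maximal k).
  apply: (comax_maximal hO); [exact: index_maximal..|] => /index_inj /esym /eqP.
  by apply/negP.
have npo : ~ p i o.
  move=> pio; apply: (prime_not1 hO (maximal_prime hO (index_maximal i))).
  by rewrite -yo; exact: submodD hpi _ _.
have Po k j : k != i -> P k j o.
  by move=> ki; apply: sub_over; apply: po; rewrite mem_filter /= ki mem_enum.
apply: npo; apply: conductor_sub_index => b Bb.
have Bo := OB Oo; have Bob : B (o * b) by exact: subringM.
have PoM k j z : k != i -> B z -> P k j (o * z).
  move=> ki Bz; have [[hPm _] _ _] := over_maximal j; rewrite mulrC.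
  by apply: (submodM hPm) => //; exact: Po.
have [allP|/existsNP[j nPj]] := pselect (forall j, P i j (o * b)).
  apply: conductor_sub; rewrite conductor_cap; split=> // k j.
  by have [Eki|ki] := eqVneq k i; [move: j; rewrite Eki | exact: PoM].
suff Fob : F (o * (b - 1)).
  rewrite (_ : o * b = o * (b - 1) + o); last by ring.
  by apply: subringD => //; exact: conductor_sub.
have Bb1 : B (b - 1) by exact: subringB.
rewrite conductor_cap; split; first exact: subringM.
move=> k l; have [Eki|ki] := eqVneq k i; last exact: PoM.
move: l; rewrite Eki => l; rewrite (one l j).
have [[hPm _] _ _] := over_maximal j.
have [//|Pob] := residue_two j Bob.
have [Poj|Poj] := residue_two j Bo; first by rewrite mulrC; exact: submodM hPm _ _.
rewrite (_ : _ * _ = (o * b - 1) - (o - 1)); last by ring.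
exact: submodB hB hPm _ _.
Qed.

Lemma residue_field i j : quot_isomorphic B (P i j) 'F_2.
Proof.
have [[hPm _] nP _] := over_maximal j; have B1 := subring1 hB.
have hPi := over_idealB j; have hPp := maximal_prime hB (over_maximal j).
have mem0 x : coset (P i j) x 0 <-> P i j x.
  split=> [[z Pz /eqP]|Px].
    by rewrite addr_eq0 => /eqP ->; rewrite -sub0r; apply: (submodB hB hPm) => //;
      exact: submod0 hPm.
  exists (- x); last by rewrite subrr.
  by rewrite -sub0r; apply: (submodB hB hPm) => //; exact: submod0 hPm.
(* The coset of x contains 0 if and only if x is in P i j. *)
pose f (C : set K) : 'F_2 := (~~ `[< C 0 >])%:R.
have f0 x : P i j x -> f (coset (P i j) x) = 0.
  by move=> Px; rewrite /f; have /asboolP -> := (mem0 x).2 Px.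
have f1 x : ~ P i j x -> f (coset (P i j) x) = 1.
  by move=> Px; rewrite /f; case: asboolP => // /mem0.
have N1 x : P i j (x - 1) -> ~ P i j x.
  move=> Px1 Px; apply: (prime_not1 hB hPp); rewrite (_ : 1 = x - (x - 1)); last by ring.
  exact: submodB hB hPm _ _.
exists f; split.
- split.
  + by [].
  + move=> _ _ /set_mem[x Bx <-] /set_mem[y By <-] E; apply/(coset_eqP _ _ hB hPm).
    have [Px|Px] := residue_two j Bx; have [Py|Py] := residue_two j By.
    * exact: submodB hB hPm _ _.
    * by move: E; rewrite f0 // f1 //; exact: N1.
    * by move: E; rewrite (f0 y) // f1 //; exact: N1.
    rewrite (_ : x - y = (x - 1) - (y - 1)); last by ring.
    exact: submodB hB hPm _ _.
  move=> c _; case: c => -[|[|//]] cc.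
    exists (coset (P i j) 0); first by exists 0 => //; exact: subring0.
    by rewrite f0; [exact: val_inj | exact: submod0 hPm].
  exists (coset (P i j) 1); first by exists 1.
  by rewrite f1; [exact: val_inj | exact: prime_not1 hPp].
- by rewrite f1 //; exact: prime_not1 hPp.
- move=> _ _ [x Bx <-] [y By <-]; rewrite (coset_addE _ _ hPi).
  have [Px|Px] := residue_two j Bx; have [Py|Py] := residue_two j By.
  + by rewrite !f0 ?addr0 //; exact: submodD hPm _ _.
  + rewrite (f0 x) // (f1 y) ?add0r; last exact: N1.
    by rewrite f1 //; apply: N1; rewrite -addrA; exact: submodD hPm _ _.
  + rewrite (f0 y) // (f1 x) ?addr0; last exact: N1.
    by rewrite f1 //; apply: N1; rewrite addrAC; exact: submodD hPm _ _.
  have P2 : P i j (1 + 1).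
    rewrite (_ : 1 + 1 = (- 1) ^+ 2 - (- 1)); last by ring.
    by apply/conductor_sub_over/hbool; exact: subringN.
  rewrite (f1 x) ?(f1 y) ?f0; [by apply: val_inj| |exact: N1..].
  rewrite (_ : x + y = (x - 1) + (y - 1) + (1 + 1)); last by ring.
  by apply: (submodD hPm) => //; exact: submodD hPm _ _.
move=> _ _ [x Bx <-] [y By <-]; rewrite (coset_mulE hPi) //.
have [Px|Px] := residue_two j Bx.
  by rewrite !(f0 x) // f0 ?mul0r // mulrC; exact: submodM hPm _ _.
have [Py|Py] := residue_two j By.
  by rewrite !(f0 y) // f0 ?mulr0 //; exact: submodM hPm _ _.
rewrite (f1 x) ?(f1 y) ?mul1r; [|exact: N1..]; rewrite f1 //; apply: N1.
rewrite (_ : _ - 1 = x * (y - 1) + (x - 1)); last by ring.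
by apply: (submodD hPm) => //; exact: submodM hPm _ _.
Qed.

End Boolean.

Lemma boolean_of_residue_two : F = \big[@mulM K/B]_(i < r) prime_part i ->
  (forall i j, quot_isomorphic B (P i j) 'F_2) -> boolean_mod_conductor.
Proof.
move=> EF res x Bx; rewrite EF product_cap; split.
  by apply: subringB => //; exact: subringX.
move=> i j; have [f [[_ finj _] _ _ fM]] := res i j.
have [hPm _] := over_idealB j.
have idem (c : 'F_2) : c * c = c by case: c => -[|[|//]] cc; exact: val_inj.
have Bxx : B (x ^+ 2) by exact: subringX.
apply/(coset_eqP _ _ hB hPm); apply: finj.
- by apply: mem_set; exists (x ^+ 2).
- by apply: mem_set; exists x.
have quot_x : quot B (P i j) (coset (P i j) x) by exists x.
rewrite expr2 -(coset_mulE (over_idealB j)) // fM //; exact: idem.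
Qed.

Theorem equivalences_over_conductor :
  [<-> set_inj (inv_ideals O) (extension B);
       set_inj (Pic O) (pic_extension B) /\ units B = units O;
       quot_units B F = quot_units O F;
       quot_units B F = [set coset F 1];
       [/\ F = \big[@mulM _/B]_(i < r) \big[@mulM _/B]_(j < s i) P i j,
           (forall i j, quot_isomorphic B (P i j) 'F_2)
         & (forall i, (2 <= s i)%N)]].
Proof.
have [hFm FB] := conductor_ideal; have [hFO FO] := conductor_idealO.
have B1 := subring1 hB; have O1 := subring1 hO.
tfae.
- exact: pic_extension_injective.
- move=> [inj EU]; have desc := units_descend_of_pic inj EU.
  apply/seteqP; split=> C.
    move=> /(quot_unitsP _ hB conductor_ideal)[x [y [Bx By EC Fxy]]].
    apply/(quot_unitsP _ hO conductor_idealO); exists x, y; split=> //.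
      exact: desc Fxy.
    by apply: (desc y x) => //; rewrite mulrC.
  move=> /(quot_unitsP _ hO conductor_idealO)[x [y [Ox Oy EC Fxy]]].
  by apply/(quot_unitsP _ hB conductor_ideal); exists x, y; split=> //; exact: OB.
- move=> E.
  have desc u v : B u -> B v -> F (u * v - 1) -> O u.
    move=> Bu Bv Fuv; have : quot_units B F (coset F u).
      by apply/(quot_unitsP _ hB conductor_ideal); exists u, v.
    rewrite E => -[[x Ox /(coset_eqP _ _ hO hFO) Fxu] _].
    rewrite (_ : u = x - (x - u)); last by ring.
    by apply: subringB => //; exact: FO.
  apply/seteqP; split=> C.
    move=> /(quot_unitsP _ hB conductor_ideal)[x [y [Bx By -> Fxy]]].
    apply/(coset_eqP _ _ hB hFm).
    exact: units_trivial_mod_conductor desc _ _ Bx By Fxy.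
  move=> ->; apply/(quot_unitsP _ hB conductor_ideal); exists 1, 1; split=> //.
  by rewrite mulr1 subrr; exact: submod0 hFm.
- move=> E; have hbool : boolean_mod_conductor.
    apply: boolean_of_units_descend => u v Bu Bv Fuv.
    have : quot_units B F (coset F u).
      by apply/(quot_unitsP _ hB conductor_ideal); exists u, v.
    rewrite E => /(coset_eqP _ _ hB hFm) Fu1.
    by rewrite -[u](subrK 1); apply: subringD => //; exact: FO.
  split; [|exact: residue_field|exact: at_least_two_over].
  by rewrite product_cap; exact: conductor_cap.
- by move=> [EF res _]; apply: extension_injective; exact: boolean_of_residue_two.
Qed.
End Indexed.
End Conductor.

(** * Integrality, finiteness and dimension *)

Section Base.
Variable R : idomainType.
Let K := {fraction R}.
Local Notation tofrac := (@FracField.tofrac R).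

Lemma base_subring : is_subring (base R).
Proof.
split; first by exists 1; rewrite ?rmorph1.
  by move=> _ _ [a _ <-] [b _ <-]; exists (a - b); rewrite ?rmorphB.
by move=> _ _ [a _ <-] [b _ <-]; exists (a * b); rewrite ?rmorphM.
Qed.

Lemma normalization_subring : is_subring (normalization R).
Proof.
split; first exact: integral1.
  by move=> x y; exact: integral_sub.
by move=> x y; exact: integral_mul.
Qed.

Lemma base_sub_normalization : base R `<=` normalization R.
Proof. by move=> _ [a _ <-]; exact: integral_id. Qed.

Lemma base_frac (x : K) : exists d, [/\ base R d, d != 0 & base R (d * x)].
Proof.
elim/quotW: x => -[[a b] /= b0].
exists (tofrac b); split; [by exists b|by rewrite tofrac_eq0|].
exists a => //; unlock FracField.tofrac; rewrite -[RHS]pi_mul.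
apply/eqmodP; rewrite /= /FracField.equivf /= /FracField.mulf.
by rewrite !numden_Ratio ?mul1r ?oner_neq0 //= mulrC.
Qed.
Lemma normalization_integral (x : K) : normalization R x ->
  exists2 l : seq K, (forall c, c \in l -> base R c)
                   & foldr (fun c y => y * x + c) 1 l = 0.
Proof.
move=> [q q_monic /rootP].
have -> : map_poly tofrac q = Poly (map tofrac q).
  by rewrite map_polyE.
case/lastP Eq: (polyseq q) => [|l c].
  by move: q_monic; rewrite monicE lead_coefE Eq /= eq_sym oner_eq0.
have -> : c = 1.
  move: q_monic; rewrite monicE lead_coefE Eq size_rcons /=.
  by rewrite nth_rcons ltnn eqxx => /eqP.
move=> E; exists (map tofrac l); first by move=> _ /mapP[a _ ->]; exists a.
rewrite -{}E horner_Poly; elim: l {Eq} => [|d l IHl] /=; last by rewrite IHl.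
by rewrite rmorph1 mul0r add0r.
Qed.

(** Cayley-Hamilton: x is an eigenvalue of the matrix over R describing the
    multiplication by x on generators of M. *)
Lemma normalization_closed (x : K) (M : set K) : noetherian (base R) ->
  ideal (base R) M -> (exists2 y, M y & y != 0) ->
  (forall y, M y -> M (x * y)) -> normalization R x.
Proof.
move=> noeth hM [y My y0] xM; have [s Es] := noeth _ hM.
have smem i : M (s`_i).
  have [lti|ges] := ltnP i (size s); last first.
    by rewrite nth_default //; case: hM => -[].
  by rewrite Es; apply: mem_span; [exact: base_subring | exact: mem_nth].
have /choice[a Ea] : forall i : 'I_(size s), exists a : 'I_(size s) -> R,
    x * s`_i = \sum_j tofrac (a j) * s`_j.
  move=> i; have := xM _ (smem i); rewrite {1}Es => -[c Oc ->].
  have /choice[a Ea] : forall j, exists aj, tofrac aj = c j.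
    by move=> j; have [aj _ <-] := Oc j; exists aj.
  by exists a; apply: eq_bigr => j _; rewrite Ea.
pose A : 'M[R]_(size s) := \matrix_(j, i) a i j.
exists (char_poly A); first exact: char_poly_monic.
rewrite map_char_poly -eigenvalue_root_char; apply/eigenvalueP.
exists (\row_j s`_j).
  apply/rowP => i; rewrite !mxE Ea; apply: eq_bigr => j _.
  by rewrite !mxE mulrC.
apply: contra_neq y0 => /rowP s0; move: My; rewrite Es => -[c _ ->].
by apply: big1 => i _; have := s0 i; rewrite !mxE => ->; rewrite mulr0.
Qed.

Lemma conductor_neq0 : fin_gen (base R) (normalization R) ->
  exists2 d, conductor (base R) (normalization R) d & d != 0.
Proof.
have hO := base_subring; move=> [s ->].
(* A common denominator of the generators of the normalization. *)
have [d [Od d0 ds]] : exists d, [/\ base R d, d != 0 &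
    forall x, x \in s -> base R (d * x)].
  elim: s => [|y s [d [Od d0 ds]]].
    by exists 1; split=> //; [exact: subring1 | exact: oner_neq0].
  have [e [Oe e0 Oey]] := base_frac y.
  exists (d * e); split; [exact: subringM | by rewrite mulf_neq0 |] => x.
  rewrite inE => /orP[/eqP->|xs]; first by rewrite -mulrA; exact: subringM.
  by rewrite mulrAC mulrC; apply: subringM => //; exact: ds.
exists d => //; apply: (span_le (A := base R)); last exact: ds.
split=> /= [|x y Ox Oy|a x Oa Ox].
- by rewrite mulr0; exact: subring0.
- by rewrite mulrDr; exact: subringD.
by rewrite mulrCA; exact: subringM.
Qed.

End Base.

Section Dimension.
Variables (K : fieldType) (A : set K).
Hypotheses (hA : is_subring A) (hdim : krull_dim A 1).

(** Otherwise a prime Q' above a proper ideal strictly containing Q would give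
    the chain 0 < Q < Q'. *)
Lemma nonzero_prime_maximal Q : prime_ideal A Q ->
  (exists2 x, Q x & x != 0) -> maximal_ideal A Q.
Proof.
move=> hQ [x Qx x0]; have [hQi nQ _] := hQ; split=> // J hJ QJ.
have [J1|J1] := pselect (J 1); first by right; exact: ideal1.
left; apply: contrapT => nJQ.
have [Q' hQ' JQ'] := prime_over hA hJ J1.
pose chain k : set K :=
  if k is k'.+1 then (if k' is 0 then Q else Q') else [set 0].
have : (2 <= 1)%N; last by [].
apply: (hdim.2 2%N chain); split=> [[|[|[|//]]] _ //|[|[|//]] _].
- split; [split; [split|]|..].
  + by [].
  + by move=> a b -> ->; rewrite addr0.
  + by move=> a b _ ->; rewrite mulr0.
  + by move=> _ ->; exact: subring0.
  + move=> E; have : A 1 by exact: subring1.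
    by rewrite -E => /eqP; rewrite oner_eq0.
  by move=> a b _ _ /eqP; rewrite mulf_eq0 => /orP[]/eqP ->; [left|right].
- split=> [_ ->|/(_ _ Qx)/eqP]; last by rewrite (negPf x0).
  by case: hQi => + _; exact: submod0.
split=> [y /QJ /JQ' //|Q'Q]; apply: nJQ; apply/seteqP; split=> //.
by move=> y /JQ' /Q'Q.
Qed.

Lemma maximal_neq0 M : maximal_ideal A M -> exists2 x, M x & x != 0.
Proof.
move=> [[hM MA] nM Mmax]; apply: contrapT => M0.
have M_eq0 x : M x -> x = 0.
  by move=> Mx; apply/eqP; apply: contrapT => /negP x0; apply: M0; exists x.
have [[P [Pprime Pchain]] _] := hdim.
have [hP0 _ _] := Pprime 0%N isT; have [hP1 nP1 _] := Pprime 1%N isT.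
have [_ nP10] := Pchain 0%N isT.
have MP1 : M `<=` P 1%N by move=> x /M_eq0 ->; case: hP1 => + _; exact: submod0.
have [E|//] := Mmax _ hP1 MP1.
by apply: nP10; rewrite E => x /M_eq0 ->; case: hP0 => + _; exact: submod0.
Qed.

End Dimension.

(** * The theorem *)

Theorem theorem5p1 (R : idomainType) (O Ot F : set {fraction R})
  (O_def : O = base R)
  (O_noetherian : noetherian O)
  (O_dim1 : krull_dim O 1)
  (Ot_def : Ot = normalization R)
  (Ot_fin_gen : fin_gen O Ot)
  (F_def : F = conductor O Ot)
  (r : nat) (p : 'I_r -> set {fraction R})
  (p_bij : set_bij [set: 'I_r] (noninvertible_maximal O) p)
  (s : 'I_r -> nat) (P : forall i : 'I_r, 'I_(s i) -> set {fraction R})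
  (P_bij : forall i, set_bij [set: 'I_(s i)] (maximal_over O Ot (p i)) (P i)) :
  [<-> set_inj (inv_ideals O) (extension Ot);
       set_inj (Pic O) (pic_extension Ot) /\ units Ot = units O;
       quot_units Ot F = quot_units O F;
       quot_units Ot F = [set coset F 1];
       [/\ F = \big[@mulM _/Ot]_(i < r) \big[@mulM _/Ot]_(j < s i) P i j,
           (forall i j, quot_isomorphic Ot (P i j) 'F_2)
         & (forall i, (2 <= s i)%N)]].
Proof.
subst O Ot F; have hO := base_subring R; have hB := normalization_subring R.
apply: equivalences_over_conductor => //.
- exact: base_sub_normalization.
- exact: base_frac.
- exact: nonzero_prime_maximal.
- exact: maximal_neq0.
- exact: normalization_integral.
- by move=> x M; exact: normalization_closed.
- exact: conductor_neq0.
exact: p_bij.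
Qed.
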